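(* Let $R$ and $S$ be connected graphs with $R\neq P_3$ and $S\neq P_3$. Then every 4-connected $\{R,S\}$-free graph with at least $9$ vertices has an $H^2$ if and only if $\{R,S\}=\{K_{1,3},Z_1\}$ or $\{R,S\}=\{K_{1,4},Z_1\}$ (that is, one graph is $Z_1$ and the other is $K_{1,3}$ or $K_{1,4}$).
   Context: All graphs are finite and simple. $P_k$ denotes the path on $k$ vertices and $K_{1,r}$ the star with $r$ leaves. $Z_1$ is the graph obtained from $K_{1,3}$ by adding one edge between two of its leaves. A graph $G$ is $\{R,S\}$-free if it contains no induced subgraph isomorphic to $R$ or to $S$. The square of a graph is obtained by adding edges joining all pairs of vertices at distance two. A graph $G$ has an $H^2$ if $G$ contains, as a subgraph, the square of some hamiltonian cycle of $G$.
   Formalization: The formal theorem also assumes that at least one 4-connected {R,S}-free graph with at least 9 vertices exists; without this the claim fails, e.g. for R=K_1, R=K_2 or {R,S}={K_3,K_{1,4}}, where the left side holds vacuously. *)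

(* Defs.v *)
From mathcomp Require Import all_boot.

Set Implicit Arguments.
Unset Strict Implicit.
Unset Printing Implicit Defensive.

Record sgraph := SGraph {
  svertex :> finType;
  sedge : rel svertex;
  sedge_sym : symmetric sedge;
  sedge_irr : irreflexive sedge
}.

Definition sg_iso (G H : sgraph) : Prop :=
  exists2 f : G -> H, bijective f & {mono f : x y / sedge x y}.

Section Induced.
Variables (G : sgraph) (A : {set G}).

Definition induced_rel : rel {x : G | x \in A} :=
  fun x y => sedge (val x) (val y).

Lemma induced_sym : symmetric induced_rel.
Proof. by move=> x y; rewrite /induced_rel sedge_sym. Qed.

Lemma induced_irr : irreflexive induced_rel.
Proof. by move=> x; rewrite /induced_rel sedge_irr. Qed.

Definition induced : sgraph := SGraph induced_sym induced_irr.

End Induced.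

Definition has_induced (H G : sgraph) : Prop :=
  exists A : {set G}, sg_iso (induced A) H.

Definition pair_free (R S G : sgraph) : Prop :=
  ~ has_induced R G /\ ~ has_induced S G.

(* The null graph is not connected. *)
Definition sg_connected (G : sgraph) : Prop :=
  0 < #|G| /\ forall x y : G, connect (@sedge G) x y.

Definition k_connected (k : nat) (G : sgraph) : Prop :=
  k < #|G| /\
  forall X : {set G}, #|X| < k -> sg_connected (induced (~: X)).

Section Path.
Variable k : nat.

Definition path_rel : rel 'I_k :=
  fun i j => (i.+1 == j :> nat) || (j.+1 == i :> nat).

Lemma path_rel_sym : symmetric path_rel.
Proof. by move=> i j; rewrite /path_rel orbC. Qed.

Lemma path_rel_irr : irreflexive path_rel.
Proof. by move=> i; rewrite /path_rel orbb gtn_eqF. Qed.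

(* P_k has k vertices, hence k - 1 edges. *)
Definition path_graph : sgraph := SGraph path_rel_sym path_rel_irr.

End Path.

Section Star.
Variable r : nat.

Definition star_rel : rel 'I_r.+1 := fun i j => (i == ord0) (+) (j == ord0).

Lemma star_rel_sym : symmetric star_rel.
Proof. by move=> i j; rewrite /star_rel addbC. Qed.

Lemma star_rel_irr : irreflexive star_rel.
Proof. by move=> i; rewrite /star_rel addbb. Qed.

(* K_{1,r}, with centre ord0. *)
Definition star : sgraph := SGraph star_rel_sym star_rel_irr.

End Star.

Section AddEdge.
Variables (G : sgraph) (u v : G).

Definition add_edge_rel : rel G := fun x y =>
  sedge x y || (x != y) && ((x == u) && (y == v) || (x == v) && (y == u)).

Lemma add_edge_sym : symmetric add_edge_rel.
Proof.
move=> x y; rewrite /add_edge_rel sedge_sym (eq_sym y x) orbC.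
by rewrite [(y == u) && _]andbC [(y == v) && _]andbC
  [((x == v) && _) || _]orbC orbC.
Qed.

Lemma add_edge_irr : irreflexive add_edge_rel.
Proof. by move=> x; rewrite /add_edge_rel sedge_irr eqxx. Qed.

Definition add_edge : sgraph := SGraph add_edge_sym add_edge_irr.

End AddEdge.

Definition Z1 : sgraph :=
  @add_edge (star 3) (@Ordinal 4 1 isT) (@Ordinal 4 2 isT).

Section Square.
Variable G : sgraph.

Definition square_rel : rel G := fun x y =>
  sedge x y || (x != y) && [exists z, sedge x z && sedge z y].

Lemma square_sym : symmetric square_rel.
Proof.
move=> x y; rewrite /square_rel sedge_sym eq_sym; congr (_ || _ && _).
by apply: eq_existsb => z; rewrite andbC sedge_sym [sedge x z]sedge_sym.
Qed.

Lemma square_irr : irreflexive square_rel.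
Proof. by move=> x; rewrite /square_rel sedge_irr eqxx. Qed.

Definition square : sgraph := SGraph square_sym square_irr.

End Square.

Section CycleGraph.
Variables (T : finType) (c : seq T).

Definition cycle_rel : rel T :=
  fun x y => (x != y) && ((next c x == y) || (next c y == x)).

Lemma cycle_rel_sym : symmetric cycle_rel.
Proof. by move=> x y; rewrite /cycle_rel eq_sym orbC. Qed.

Lemma cycle_rel_irr : irreflexive cycle_rel.
Proof. by move=> x; rewrite /cycle_rel eqxx. Qed.

(* The graph on T whose edges join cyclically consecutive entries of c; the
   elements of T outside c are isolated, since next fixes them. *)
Definition cycle_graph : sgraph := SGraph cycle_rel_sym cycle_rel_irr.

End CycleGraph.

Definition hamiltonian_cycle (G : sgraph) (c : seq G) : Prop :=
  [/\ 2 < size c, uniq c, forall x : G, x \in c & cycle (@sedge G) c].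

Definition has_H2 (G : sgraph) : Prop :=
  exists2 c : seq G, hamiltonian_cycle c &
    forall x y : G, @sedge (square (cycle_graph c)) x y -> sedge x y.

(* {R, S} = {H, K} as unordered pairs of isomorphism types. *)
Definition same_pair (R S H K : sgraph) : Prop :=
  (sg_iso R H /\ sg_iso S K) \/ (sg_iso R K /\ sg_iso S H).

(* Main.v *)
Require Import Defs.
From mathcomp Require Import all_boot.
From mathcomp Require Import zify.
From Stdlib Require Import Classical_Prop.

(* Sufficiency.  In a 4-connected {K_{1,4}, Z1}-free graph every vertex has four
   neighbours, two of which are adjacent, so every vertex lies in a triangle.
   Following Olariu, Z1-freeness then makes non-adjacency transitive, so the
   graph is complete multipartite, and its parts have at most three vertices.
   List the vertices part by part, the parts of size three first; visiting the
   positions 0, 3, 6, ..., 1, 4, 7, ..., 2, 5, 8, ... keeps vertices of a common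
   part at cyclic distance at least three.

   Necessity.  Five 4-connected graphs on at least nine vertices without an H^2
   must each contain R or S.  Both R and S have at least four vertices, because
   the graph with an H^2 given by non-vacuity contains K_1, K_2 and K_3.  Say R
   is induced in K_{4,5}; then R contains a claw or a 4-cycle.  The line graph of
   the Petersen graph has neither, so it contains S; hence S is Z1 or contains a
   P_4 or a bowtie (two triangles sharing a vertex).  The graphs
   (K_1 + K_3) v (K_1 + K_4) and K_4 v 5 K_1 contain neither P_4 nor bowtie, while
   the first is claw-free and the second C_4-free, so S = Z1.  Finally the
   4-regular Robertson graph of girth five is Z1-free, so it contains R, which
   therefore is a star with three or four leaves.  The finite facts about these
   graphs are decided by enumeration. *)

Set Implicit Arguments.
Unset Strict Implicit.
Unset Printing Implicit Defensive.

(** * Sequences of distinct vertices grown by a rule *)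

Section Build.
Variables (T : eqType) (p : T -> seq T -> bool).

Fixpoint buildable (s : seq T) : bool :=
  if s is x :: s' then [&& x \notin s', p x s' & buildable s'] else true.

Fixpoint build (V : seq T) (k : nat) : seq (seq T) :=
  if k is k'.+1 then
    flatten [seq [seq x :: s | x <- V & (x \notin s) && p x s] | s <- build V k']
  else [:: [::]].

(** This equivalence turns each finite fact below into a check over a computed list. *)
Lemma mem_build V k s :
  (s \in build V k) = [&& size s == k, all (mem V) s & buildable s].
Proof.
elim: k s => [|k IHk] s /=; first by rewrite inE; case: s.
apply/flatten_mapP/idP => [[s' s'P /mapP[x]]|].
  rewrite mem_filter => /andP[/andP[xs' pxs'] xV] ->.
  by move: s'P; rewrite IHk /= eqSS xs' pxs' xV.
case: s => [|x s] //= /and3P[sk /andP[xV sV] /and3P[xs pxs bs]].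
exists s; first by rewrite IHk -eqSS sk sV.
by apply/mapP; exists x; rewrite // mem_filter xs pxs.
Qed.

Lemma buildable_uniq s : buildable s -> uniq s.
Proof. by elim: s => //= x s IHs /and3P[-> _ /IHs]. Qed.

Lemma buildable_drop k s : buildable s -> buildable (drop k s).
Proof. by elim: s k => [|x s IHs] [|k] //= /and3P[_ _ /IHs]. Qed.

End Build.

(* Row k of the pattern r lists the adjacencies of the k-th chosen vertex to the
   earlier ones; the latest vertex is the head of s. *)
Definition occ_rule (T : eqType) (e : rel T) (r : rel nat) : T -> seq T -> bool :=
  fun x s => map (e x) (rev s) == mkseq (r (size s)) (size s).

Definition grow_rule (T : eqType) (e : rel T) : T -> seq T -> bool :=
  fun x s => nilp s || has (e x) s.

(** The adjacencies along the square of a path. *)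
Definition window_rule (T : eqType) (e : rel T) : T -> seq T -> bool :=
  fun x s => all (e x) (take 2 s).

Definition occs (T : eqType) (e : rel T) (r : rel nat) (k : nat) (V : seq T) : bool :=
  ~~ nilp (build (occ_rule e r) V k).

Section MapBuild.
Variables (T U : eqType) (f : T -> U) (p : T -> seq T -> bool) (q : U -> seq U -> bool).
Hypothesis f_inj : injective f.
Hypothesis qf : forall x s, q (f x) (map f s) = p x s.

Lemma map_buildable s : buildable q (map f s) = buildable p s.
Proof. by elim: s => //= x s ->; rewrite mem_map // qf. Qed.

Lemma map_build V k : build q (map f V) k = map (map f) (build p V k).
Proof.
elim: k => //= k ->; rewrite map_flatten -!map_comp; congr flatten.
apply: eq_map => s /=; rewrite filter_map -!map_comp.
rewrite (eq_filter (a2 := fun x => (x \notin s) && p x s)) //.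
by move=> x /=; rewrite mem_map // qf.
Qed.

End MapBuild.

(** * Graphs given by adjacency tables *)

Definition table_adj (g : seq (seq nat)) : rel nat :=
  fun i j => (i != j) && ((j \in nth [::] g i) || (i \in nth [::] g j)).

Section TableGraph.
Variable g : seq (seq nat).
Definition table_rel : rel 'I_(size g) := fun i j => table_adj g i j.
Lemma table_rel_sym : symmetric table_rel.
Proof. by move=> i j; rewrite /table_rel /table_adj eq_sym orbC. Qed.
Lemma table_rel_irr : irreflexive table_rel.
Proof. by move=> i; rewrite /table_rel /table_adj eqxx. Qed.
Definition table_graph : sgraph := SGraph table_rel_sym table_rel_irr.
End TableGraph.

(** The argument [k] is fuel. Deleted vertices are put in [vis] at the start, so the search never
    expands them. *)
Fixpoint dfs_avoid (g : seq (seq nat)) (k : nat) (vis : seq nat) (x : nat) :=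
  if x \in vis then vis
  else if k is k'.+1 then foldl (dfs_avoid g k') (x :: vis) (nth [::] g x) else vis.

Definition connected_without g (X : seq nat) : bool :=
  if [seq i <- iota 0 (size g) | i \notin X] is r :: _ then
    all (mem (dfs_avoid g (size g) X r)) (iota 0 (size g))
  else false.

(** As a rule for [build], this lists every vertex subset once, as its increasing enumeration. *)
Definition increasing (x : nat) (s : seq nat) := all (ltn x) s.

Definition four_connected g : bool :=
  (4 < size g) &&
  all (fun k => all (connected_without g) (build increasing (iota 0 (size g)) k)) (iota 0 4).

Section Rules.
Variables (T U : eqType) (f : T -> U) (e : rel T) (e' : rel U).
Hypothesis f_inj : injective f.
Hypothesis fe : forall x y, e' (f x) (f y) = e x y.

Lemma map_occ_rule r x s : occ_rule e' r (f x) (map f s) = occ_rule e r x s.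
Proof.
rewrite /occ_rule -map_rev -map_comp size_map; congr (_ == _).
by apply: eq_map => y /=.
Qed.

Lemma map_grow_rule x s : grow_rule e' (f x) (map f s) = grow_rule e x s.
Proof.
rewrite /grow_rule /nilp size_map has_map; congr (_ || _).
by apply: eq_has => y /=.
Qed.

Lemma map_window_rule x s : window_rule e' (f x) (map f s) = window_rule e x s.
Proof. by rewrite /window_rule -map_take all_map; apply: eq_all => y /=. Qed.

Lemma map_occs r k V : occs e' r k (map f V) = occs e r k V.
Proof.
by rewrite /occs (map_build f_inj (map_occ_rule r)) /nilp size_map.
Qed.

End Rules.

(** * Induced patterns and embeddings *)

Lemma occsP (T : eqType) (e : rel T) r k V :
  reflect (exists s, [/\ size s = k, {subset s <= V} & buildable (occ_rule e r) s])
    (occs e r k V).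
Proof.
apply: (iffP idP) => [|[s [sk sV bs]]]; rewrite /occs.
  case E: (build _ _ _) => [|s b] // _; exists s.
  have: s \in build (occ_rule e r) V k by rewrite E mem_head.
  by rewrite mem_build => /and3P[/eqP sk /allP sV bs].
suff: s \in build (occ_rule e r) V k by case: (build _ _ _).
by rewrite mem_build sk eqxx bs andbT; apply/allP.
Qed.

Lemma occ_nth (T : eqType) (e : rel T) r x0 s i j :
    buildable (occ_rule e r) s -> i < j < size s ->
  e (nth x0 (rev s) j) (nth x0 (rev s) i) = r j i.
Proof.
elim: s => [|x s IHs] /=; first by rewrite ltn0 andbF.
case/and3P=> _ /eqP rx bs /andP[ij]; rewrite ltnS rev_cons !nth_rcons size_rev.
rewrite leq_eqVlt => /predU1P[js | js]; last first.
  by rewrite (ltn_trans ij js) js IHs // ij js.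
rewrite js ltnn eqxx -js ij.
have := congr1 (fun t => nth false t i) rx.
by rewrite (nth_map x0) ?size_rev -?js // nth_mkseq.
Qed.

Lemma emb_of_occ (G : sgraph) k (e : rel 'I_k) (r : rel nat) (s : seq G) :
    symmetric e -> irreflexive e -> (forall i j : 'I_k, i < j -> e j i = r j i) ->
    size s = k -> buildable (occ_rule (@sedge G) r) s ->
  exists2 f : 'I_k -> G, injective f & {mono f : i j / e i j >-> sedge i j}.
Proof.
case: s => [|x0 s'] e_sym e_irr er sk bs.
  (* An empty [s] offers no default for [nth], but then [k] is 0 and the domain is empty. *)
  by exists (fun i => False_rect _ (notF (ltn_ord (cast_ord (esym sk) i)))) => i;
    case: (notF (ltn_ord (cast_ord (esym sk) i))).
set s := x0 :: s' in sk bs.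
have f_lt (i j : 'I_k) : i < j ->
    sedge (nth x0 (rev s) j) (nth x0 (rev s) i) = e j i.
  by move=> ij; rewrite er // (occ_nth _ bs) // ij sk ltn_ord.
exists (fun i : 'I_k => nth x0 (rev s) i) => i j.
  move/eqP; rewrite nth_uniq ?size_rev ?sk ?rev_uniq ?(buildable_uniq bs) //.
  by move/eqP/val_inj.
case: (ltngtP i j) => [ij | ji | /val_inj->].
- by rewrite sedge_sym e_sym f_lt.
- exact: f_lt.
- by rewrite e_irr sedge_irr.
Qed.

Lemma iso_of_emb (H G : sgraph) (f : H -> G) :
  injective f -> {mono f : x y / sedge x y} -> #|G| <= #|H| -> sg_iso G H.
Proof.
move=> f_inj f_mono GH; have [f' fK f'K] := inj_card_bij f_inj GH.
exists f' => [|x y]; first by exists f.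
by rewrite -f_mono !f'K.
Qed.

Lemma has_inducedP (H G : sgraph) :
  has_induced H G <->
  exists2 f : H -> G, injective f & {mono f : x y / sedge x y}.
Proof.
split=> [[A [h [h' hK h'K] h_mono]] | [f f_inj f_mono]].
  exists (val \o h') => [|x y].
    by apply: inj_comp val_inj (can_inj h'K).
  by rewrite -{2}(h'K x) -{2}(h'K y) h_mono.
pose A := [set f x | x in H].
have fA x : f x \in A by apply: imset_f.
exists A; apply: (@iso_of_emb H (induced A) (fun x => exist _ (f x) (fA x))).
- by move=> x y /(congr1 val); apply: f_inj.
- by move=> x y; apply: f_mono.
- by rewrite card_sig (eq_card (B := A)) ?card_imset.
Qed.

(** * Growing connected vertex sequences *)

Lemma leaving_edge (T : eqType) (e : rel T) (s : seq T) x p :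
    symmetric e -> x \in s -> path e x p -> last x p \notin s ->
  exists2 y, y \notin s & has (e y) s.
Proof.
move=> e_sym; elim: p x => [|y p IHp] x xs /=; first by rewrite xs.
case/andP=> xy py; have [/IHp|ys _] := boolP (y \in s); first exact.
by exists y => //; apply/hasP; exists x; rewrite // e_sym.
Qed.

Lemma connected_grow (G : sgraph) (s : seq G) :
    sg_connected G -> size s < #|G| ->
  exists2 x, x \notin s & grow_rule (@sedge G) x s.
Proof.
case=> _ G_conn sG.
have [y ys]: exists y, y \notin s.
  apply/existsP; apply: contraLR sG; rewrite negb_exists -leqNgt => /forallP sT.
  apply: leq_trans (card_size s); apply: subset_leq_card.
  by apply/subsetP=> y _; move: (sT y); rewrite negbK.
case: s sG ys => [|z s] _ ys; first by exists y.
have /connectP[p zp yp] := G_conn z y; rewrite yp in ys.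
exact: leaving_edge (@sedge_sym G) (mem_head z s) zp ys.
Qed.

Lemma connected_grow_seq (G : sgraph) k : sg_connected G -> k <= #|G| ->
  exists2 s, size s = k & buildable (grow_rule (@sedge G)) s.
Proof.
move=> G_conn; elim: k => [|k IHk] kG; first by exists [::].
have [s sk bs] := IHk (ltnW kG).
have [|x xs xe] := connected_grow (s := s) G_conn; first by rewrite sk.
by exists (x :: s); rewrite /= ?sk // xs xe.
Qed.

(** * Consecutive vertices of an H^2 *)

Section H2window.
Variables (G : sgraph) (c : seq G).
Hypothesis c_cycle : hamiltonian_cycle c.
Hypothesis c_square :
  forall x y : G, @sedge (square (cycle_graph c)) x y -> sedge x y.

Lemma next_sedge x : sedge x (next c x) /\ sedge x (next c (next c x)).
Proof.
have [c2 c_uniq c_all _] := c_cycle.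
(* With [x] rotated to the front, its two successors are read off; a length above two makes all
   three distinct. *)
have [i p cp] := rot_to (c_all x).
have : uniq (x :: p) by rewrite -cp rot_uniq.
have : 2 < size (x :: p) by rewrite -cp size_rot.
case: p cp => [|y [|z p]] //= cp _.
rewrite !inE !negb_or => /and3P[/and3P[xy xz _] /andP[yz _] _].
have nx : next c x = y by rewrite -(next_rot i c_uniq) cp /= eqxx.
have ny : next c y = z by rewrite -(next_rot i c_uniq) cp /= eq_sym (negPf xy) eqxx.
rewrite nx ny; split; apply: c_square; rewrite /= /square_rel /=.
  by rewrite /cycle_rel xy nx eqxx.
apply/orP; right; rewrite xz; apply/existsP; exists y.
by rewrite /cycle_rel xy yz nx ny !eqxx.
Qed.

End H2window.

(** No window shorter than eight refutes an H^2 in [K4coK5]. Index 5 keeps at least two entries on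
    either side of [x], which is what [twoCliques] requires. *)
Lemma H2_window (G : sgraph) (x : G) : has_H2 G -> 9 <= #|G| ->
  exists s, [/\ size s = 8, buildable (window_rule (@sedge G)) s & nth x s 5 = x].
Proof.
case=> c c_cycle c_square G9.
have [c2 c_uniq c_all _] := c_cycle.
pose f := next c; pose y := iter 5 (prev c) x.
have fy : iter 5 f y = x by rewrite /f /y /= !next_prev.
have [i p cp] := rot_to (c_all y).
have c9 : 9 <= size c.
  by apply: leq_trans G9 (leq_trans _ (card_size c)); apply/subset_leq_card/subsetP.
have /fpathP[m pm]: fpath f y p.
  have := cycle_next c_uniq; rewrite -/f -(rot_cycle i) cp /= rcons_path.
  by case/andP.
have : uniq (take 8 (y :: p)) by rewrite take_uniq // -cp rot_uniq.
have m8: 8 <= m.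
  by move: c9; rewrite -(size_rot i) cp /= pm size_traject.
have -> : take 8 (y :: p) = traject f y 8.
  by rewrite -(subnKC m8) in pm; rewrite pm.
move=> s_uniq; exists (traject f y 8); split; rewrite ?size_traject //.
have e1 z : sedge z (f z) by case: (next_sedge c_cycle c_square z).
have e2 z : sedge z (f (f z)) by case: (next_sedge c_cycle c_square z).
elim: 8 (y) s_uniq => //= k IHk z /andP[zk /IHk->].
by rewrite zk andbT /window_rule; case: (k) => [|[|k']] //=; rewrite ?take0 ?e1 ?e2.
Qed.

(** * Soundness of the connectivity test *)

Lemma mem_dfs_avoid (g : seq (seq nat)) (X : seq nat) (C : nat -> Prop) k (vis : seq nat) x :
    (forall x y, x \notin X -> C x -> y \in nth [::] g x -> C y) ->
    {subset X <= vis} -> C x -> (forall y, y \in vis -> C y) ->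
  forall y, y \in dfs_avoid g k vis x -> C y.
Proof.
move=> C_step.
(* The inclusion of [X] in the visited list is carried through the fold: it shows that a vertex not
   yet visited lies outside [X], where [C_step] applies. *)
suff: {subset X <= vis} -> C x -> (forall y, y \in vis -> C y) ->
  {subset X <= dfs_avoid g k vis x} /\ forall y, y \in dfs_avoid g k vis x -> C y.
  by move=> H Xv Cx Cv; case: (H Xv Cx Cv).
elim: k vis x => [|k IHk] vis x Xv Cx Cv /=; first by case: ifP.
case: ifPn => // xvis.
have xX : x \notin X by apply: contra xvis => /Xv.
have: {subset X <= x :: vis} by move=> z /Xv zv; rewrite inE zv orbT.
have: forall y, y \in x :: vis -> C y by move=> y; rewrite inE => /predU1P[-> | /Cv].
have := C_step x _ xX Cx.
elim: (nth [::] g x) (x :: vis) => [|z ys IHys] vis' /= Cys Cvis' Xvis'; first by [].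
have [//| |//|XD CD] := IHk vis' z; first by apply: Cys; rewrite mem_head.
by apply: IHys => // y yys; apply: Cys; rewrite inE yys orbT.
Qed.

Lemma sorted_buildable (s : seq nat) : sorted ltn s -> buildable increasing s.
Proof.
elim: s => //= x s IHs xs; rewrite IHs ?(path_sorted xs) // andbT.
have xmin : all (ltn x) s := order_path_min ltn_trans xs.
by rewrite /increasing xmin andbT; apply/negP => /(allP xmin); rewrite /= ltnn.
Qed.

Lemma four_connectedP (g : seq (seq nat)) :
  four_connected g -> k_connected 4 (table_graph g).
Proof.
case/andP=> g4 /allP check; split; first by rewrite card_ord.
move=> X X4; set n := size g in g4 check *.
pose Xs : seq nat := map val (enum X).
have mem_Xs (i : table_graph g) : (val i \in Xs) = (i \in X).
  by rewrite mem_map ?mem_enum //; apply: val_inj.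
have: Xs \in build increasing (iota 0 n) #|X|.
  rewrite mem_build size_map -cardE eqxx andTb; apply/andP; split.
    by apply/allP=> _ /mapP[i _ ->]; rewrite inE mem_iota ltn_ord.
  apply: sorted_buildable; apply: (subseq_sorted ltn_trans (s2 := map val (enum 'I_n))).
    by apply: map_subseq; rewrite enumT; apply: filter_subseq.
  by rewrite val_enum_ord iota_ltn_sorted.
have /check/allP check_X : #|X| \in iota 0 4 by rewrite mem_iota.
move/check_X; rewrite /connected_without -/n.
case E: [seq i <- iota 0 n | i \notin Xs] => [|r V] // /allP r_all.
have: r \in [seq i <- iota 0 n | i \notin Xs] by rewrite E mem_head.
rewrite mem_filter mem_iota /= add0n => /andP[rX rn].
pose r0 : table_graph g := Ordinal rn.
have r0X : r0 \in ~: X by rewrite inE -mem_Xs.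
pose r1 : induced (~: X) := exist _ r0 r0X.
have r_conn (x : induced (~: X)) : connect (@sedge (induced (~: X))) r1 x.
  (* The search runs on naturals, so the invariant speaks of the surviving vertices of index [i]; it
     is vacuous for deleted ones. *)
  pose C i := forall x : induced (~: X), val (val x) = i ->
    connect (@sedge (induced (~: X))) r1 x.
  apply: (@mem_dfs_avoid g Xs C n Xs r _ _ _ _ (val (val x))) => //.
  - move=> i j iX Ci ij y yj.
    have i_n : i < n by rewrite ltnNge; apply: contraL ij => /(nth_default [::])->.
    have i0X : (Ordinal i_n : table_graph g) \in ~: X by rewrite inE -mem_Xs.
    pose i1 : induced (~: X) :=
      exist (fun z : table_graph g => z \in ~: X) (Ordinal i_n) i0X.
    (* A table row may list its own vertex; such a step stays in place. *)
    have := Ci i1 erefl; have [ij1 | nij] := eqVneq i j.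
      suff -> : i1 = y by [].
      by apply/val_inj/val_inj; rewrite yj.
    move/connect_trans; apply; apply: connect1.
    by rewrite /= /induced_rel /= /table_rel /table_adj /= yj nij ij.
  - by move=> y yr; suff -> : y = r1 by []; apply/val_inj/val_inj.
  - move=> i iX y yi; have := valP y.
    by rewrite inE -mem_Xs yi iX.
  - by apply: r_all; rewrite mem_iota ltn_ord.
split=> [|x y]; first by apply/card_gt0P; exists r1.
by rewrite (connect_trans _ (r_conn y)) // (sym_connect_sym (@sedge_sym _)).
Qed.

(** * The five graphs and the patterns sought in them *)

Definition K45 : seq (seq nat) := nseq 4 (iota 4 5) ++ nseq 5 (iota 0 4).
(* (K_1 + K_3) v (K_1 + K_4), with cliques {0}, {1,2,3}, {4} and {5,...,8}.  The
   loops listed here and below are discarded by table_adj. *)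
Definition twoCliques : seq (seq nat) :=
  [:: iota 4 5] ++ nseq 3 (iota 1 8) ++ [:: iota 0 4] ++ nseq 4 (iota 0 4 ++ iota 5 4).
Definition K4coK5 : seq (seq nat) := nseq 4 (iota 0 9) ++ nseq 5 (iota 0 4).
(* The outer edge joining i to i+1 is i, the spoke at i is 5+i and the inner edge
   joining i to i+2 is 10+i. *)
Definition LPetersen : seq (seq nat) :=
  [seq [:: (i + 1) %% 5; (i + 4) %% 5; 5 + i; 5 + (i + 1) %% 5] | i <- iota 0 5] ++
  [seq [:: i; (i + 4) %% 5; 10 + i; 10 + (i + 3) %% 5] | i <- iota 0 5] ++
  [seq [:: 5 + i; 5 + (i + 2) %% 5; 10 + (i + 2) %% 5; 10 + (i + 3) %% 5] | i <- iota 0 5].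
Definition Robertson : seq (seq nat) :=
  [:: [:: 1; 6; 12; 18]; [:: 0; 2; 10; 16]; [:: 1; 3; 7; 14]; [:: 2; 4; 11; 18];
      [:: 3; 5; 8; 16]; [:: 4; 6; 10; 13]; [:: 0; 5; 7; 15]; [:: 2; 6; 8; 17];
      [:: 4; 7; 9; 12]; [:: 8; 10; 14; 18]; [:: 1; 5; 9; 11]; [:: 3; 10; 12; 15];
      [:: 0; 8; 11; 13]; [:: 5; 12; 14; 17]; [:: 2; 9; 13; 15]; [:: 6; 11; 14; 16];
      [:: 1; 4; 15; 17]; [:: 7; 13; 16; 18]; [:: 0; 3; 9; 17]].

(** Patterns are read only at [i < j], so they need not be symmetric. *)
Definition star_adj (j i : nat) := i == 0.
(** On four vertices this is the cycle C_4. *)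
Definition bip_adj (j i : nat) := odd (i + j).
Definition path_adj (j i : nat) := j == i.+1.
(* The triangles 0 1 2 and 0 3 4 sharing the vertex 0; the first four vertices
   span Z1. *)
Definition bowtie_adj (j i : nat) := (i == 0) || odd i && (j == i.+1).

Definition contains (G : sgraph) (r : rel nat) (k : nat) : Prop :=
  exists2 s : seq G, size s = k & buildable (occ_rule (@sedge G) r) s.

Definition vertices (g : seq (seq nat)) := iota 0 (size g).

Definition lies_in (G : sgraph) (g : seq (seq nat)) : Prop :=
  exists f : G -> nat, [/\ injective f, forall x, f x \in vertices g
    & forall x y, table_adj g (f x) (f y) = sedge x y].

Lemma lies_in_of_induced G g : has_induced G (table_graph g) -> lies_in G g.
Proof.
move/has_inducedP => [f f_inj f_mono].
exists (fun x => val (f x)); split.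
- by apply: inj_comp f_inj; apply: val_inj.
- by move=> x; rewrite mem_iota ltn_ord.
- by move=> x y; rewrite -f_mono.
Qed.

Section LiesIn.
Variables (G : sgraph) (g : seq (seq nat)).
Hypothesis Gg : lies_in G g.

Lemma lies_in_avoids r k :
  occs (table_adj g) r k (vertices g) = false -> ~ contains G r k.
Proof.
case: Gg => f [f_inj fV fe] /occsP gN [s sk bs]; apply: gN.
exists (map f s); rewrite size_map (map_buildable f_inj (map_occ_rule fe r)).
by split=> // _ /mapP[x _ ->].
Qed.

(** A connected set of [k] vertices of [G] maps to one of the listed sequences of [g], and any
    pattern found there pulls back to [G]. A check over that list thus decides what [G] must
    contain. *)
Lemma lies_in_grow_seq k : sg_connected G -> k <= #|G| ->
  exists2 s, s \in build (grow_rule (table_adj g)) (vertices g) k &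
    forall r m, occs (table_adj g) r m s -> contains G r m.
Proof.
case: Gg => f [f_inj fV fe] G_conn kG.
have [s sk bs] := connected_grow_seq G_conn kG.
exists (map f s) => [|r m].
  rewrite mem_build size_map sk eqxx (map_buildable f_inj (map_grow_rule fe)) bs andbT.
  by apply/allP=> _ /mapP[x _ ->]; apply: fV.
by rewrite (map_occs f_inj fe) => /occsP[t [tm _ bt]]; exists t.
Qed.

Lemma lies_in_grow r k : sg_connected G -> k < #|G| -> contains G r k ->
  exists s x, [/\ s \in build (occ_rule (table_adj g) r) (vertices g) k,
    x \in [seq x <- vertices g | (x \notin s) && grow_rule (table_adj g) x s] &
    forall r' m, occs (table_adj g) r' m (x :: s) -> contains G r' m].
Proof.
case: Gg => f [f_inj fV fe] G_conn kG [s sk bs].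
have [|x xs xe] := connected_grow (s := s) G_conn; first by rewrite sk.
exists (map f s), (f x); split.
- rewrite mem_build size_map sk eqxx (map_buildable f_inj (map_occ_rule fe r)) bs andbT.
  by apply/allP=> _ /mapP[y _ ->]; apply: fV.
- by rewrite mem_filter mem_map // xs (map_grow_rule fe) xe fV.
- move=> r' m; rewrite -map_cons (map_occs f_inj fe) => /occsP[t [tm _ bt]].
  by exists t.
Qed.

End LiesIn.

Lemma table_graph_window g x : has_H2 (table_graph g) -> 9 <= size g -> x < size g ->
  exists s, [/\ s \in build (window_rule (table_adj g)) (vertices g) 8 & nth x s 5 = x].
Proof.
move=> gH2 g9 xg.
have [|s [s8 bs sx]] := @H2_window (table_graph g) (Ordinal xg) gH2; first by rewrite card_ord.
have fe (i j : table_graph g) : table_adj g (val i) (val j) = sedge i j by [].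
exists (map val s); split.
  rewrite mem_build size_map s8 (map_buildable val_inj (map_window_rule fe)) bs andbT.
  by apply/allP=> _ /mapP[y _ ->]; rewrite inE mem_iota ltn_ord.
by rewrite (nth_map (Ordinal xg)) ?s8 // sx.
Qed.

Definition no_window g k := nilp (build (window_rule (table_adj g)) (vertices g) k).

(** The last [k] of eight consecutive vertices again form a window, so a shallow search can
    suffice. *)
Lemma no_window_no_H2 g k :
  9 <= size g -> k <= 8 -> no_window g k -> ~ has_H2 (table_graph g).
Proof.
move=> g9 k8 no gH2; have [|s []] := @table_graph_window g 0 gH2 g9; first exact: leq_trans g9.
rewrite mem_build => /and3P[/eqP s8 sV bs] _.
have: drop (8 - k) s \in build (window_rule (table_adj g)) (vertices g) k.
  rewrite mem_build size_drop s8 subKn // eqxx buildable_drop // andbT.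
  by apply/allP=> x /mem_drop /(allP sV).
by move: no; rewrite /no_window; case: build.
Qed.

(** * Necessity *)

Definition counterexample (g : seq (seq nat)) : Prop :=
  [/\ k_connected 4 (table_graph g), 9 <= size g & ~ has_H2 (table_graph g)].

(* K45 and the Robertson graph are triangle-free and no edge of LPetersen lies in
   two triangles; of eight consecutive vertices in an H^2 of K4coK5 at most three
   would lie outside the clique of order four; and vertex 0 is isolated in the
   neighbourhood {0,1,2,3} of the vertex 4 of twoCliques. *)
Lemma K45_counterexample : counterexample K45.
Proof.
split; [by apply: four_connectedP; vm_compute | by [] |].
by apply: (@no_window_no_H2 _ 3); vm_compute.
Qed.

Lemma Robertson_counterexample : counterexample Robertson.
Proof.
split; [by apply: four_connectedP; vm_compute | by [] |].
by apply: (@no_window_no_H2 _ 3); vm_compute.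
Qed.

Lemma LPetersen_counterexample : counterexample LPetersen.
Proof.
split; [by apply: four_connectedP; vm_compute | by [] |].
by apply: (@no_window_no_H2 _ 4); vm_compute.
Qed.

Lemma K4coK5_counterexample : counterexample K4coK5.
Proof.
split; [by apply: four_connectedP; vm_compute | by [] |].
by apply: (@no_window_no_H2 _ 8); vm_compute.
Qed.

Lemma twoCliques_counterexample : counterexample twoCliques.
Proof.
split; [by apply: four_connectedP; vm_compute | by [] |].
move=> /(@table_graph_window _ 4)[//|//|s []].
rewrite mem_build => /and3P[/eqP s8 sV bs] s4.
(* Dropping three entries moves the vertex 4 from index 5 to index 2, the middle of five; its only
   four neighbours would then be the other entries. *)
have s_in : drop 3 s \in build (window_rule (table_adj twoCliques)) (vertices twoCliques) 5.
  rewrite mem_build size_drop s8 buildable_drop // andbT.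
  by apply/allP=> x /mem_drop /(allP sV).
have /allP/(_ _ s_in) : all (fun t => nth 4 t 2 != 4)
    (build (window_rule (table_adj twoCliques)) (vertices twoCliques) 5) by vm_compute.
by rewrite nth_drop [nth _ _ _]s4.
Qed.

Lemma occs_self (T : eqType) (e : rel T) r s :
  buildable (occ_rule e r) s -> occs e r (size s) s.
Proof. by move=> bs; apply/occsP; exists s; split=> // x. Qed.

(** A connected set of four vertices splits between the two sides as 1+3 or 2+2. *)
Lemma K45_claw_or_C4 s : s \in build (grow_rule (table_adj K45)) (vertices K45) 4 ->
  occs (table_adj K45) star_adj 4 s || occs (table_adj K45) bip_adj 4 s.
Proof. by move: s; apply/allP; vm_compute. Qed.

(** The line graph of a cubic graph of girth five has no induced claw, C_4, diamond or K_4, which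
    leaves P_4 and Z_1 among connected graphs on four vertices. *)
Lemma LPetersen_P4_or_Z1 s :
    s \in build (grow_rule (table_adj LPetersen)) (vertices LPetersen) 4 ->
  occs (table_adj LPetersen) path_adj 4 s || occs (table_adj LPetersen) bowtie_adj 4 s.
Proof. by move: s; apply/allP; vm_compute. Qed.

Lemma LPetersen_grow_Z1 s x :
    s \in build (occ_rule (table_adj LPetersen) bowtie_adj) (vertices LPetersen) 4 ->
    x \in [seq x <- vertices LPetersen | (x \notin s) && grow_rule (table_adj LPetersen) x s] ->
  occs (table_adj LPetersen) path_adj 4 (x :: s) || occs (table_adj LPetersen) bowtie_adj 5 (x :: s).
Proof. by move=> sV; move: x; apply/allP; move: s sV; apply/allP; vm_compute. Qed.

(* A conditional rather than a disjunction, which call-by-value reduction would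
   evaluate on both sides. *)
Definition K45_star_check k : bool :=
  all (fun s => all (fun x => if occ_rule (table_adj K45) star_adj x s then true
                              else occs (table_adj K45) bip_adj 4 (x :: s))
    [seq x <- vertices K45 | (x \notin s) && grow_rule (table_adj K45) x s])
  (build (occ_rule (table_adj K45) star_adj) (vertices K45) k).

(** For the sizes checked below, a vertex added on the side of the leaves is a new leaf, and one
    added on the side of the centre closes a 4-cycle with the centre and two leaves. *)
Lemma K45_grow_star k s x : K45_star_check k ->
    s \in build (occ_rule (table_adj K45) star_adj) (vertices K45) k ->
    x \in [seq x <- vertices K45 | (x \notin s) && grow_rule (table_adj K45) x s] ->
  occs (table_adj K45) star_adj k.+1 (x :: s) || occs (table_adj K45) bip_adj 4 (x :: s).
Proof.
move=> /allP check s_in x_in; have /allP/(_ x x_in) := check s s_in.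
move: s_in x_in; rewrite mem_build mem_filter => /and3P[/eqP <- _ bs] /andP[/andP[xs _] _].
case: ifP => [x_rule _ | _ ->]; last by rewrite orbT.
by rewrite (@occs_self _ _ _ (x :: s)) //= xs x_rule.
Qed.

Lemma star_emb (G : sgraph) r : contains G star_adj r.+1 ->
  exists2 f : star r -> G, injective f & {mono f : x y / sedge x y}.
Proof.
case=> s sr bs; apply: (emb_of_occ (@star_rel_sym r) (@star_rel_irr r) _ sr bs) => i j ij.
by rewrite /star_rel -!val_eqE /= -[X in X (+) _]negbK -lt0n (leq_ltn_trans _ ij).
Qed.

Lemma Z1_emb (G : sgraph) : contains G bowtie_adj 4 ->
  exists2 f : Z1 -> G, injective f & {mono f : x y / sedge x y}.
Proof.
case=> s s4 bs; apply: (emb_of_occ (@sedge_sym Z1) (@sedge_irr Z1) _ s4 bs) => i j.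
by case: i => -[|[|[|[|i]]]] // i4; case: j => -[|[|[|[|j]]]] // j4.
Qed.

Lemma star_iso (G : sgraph) r : #|G| = r.+1 -> contains G star_adj r.+1 -> sg_iso G (star r).
Proof.
move=> Gr /star_emb[f f_inj f_mono].
by apply: iso_of_emb f_inj f_mono _; rewrite card_ord Gr.
Qed.

Lemma Z1_iso (G : sgraph) : #|G| = 4 -> contains G bowtie_adj 4 -> sg_iso G Z1.
Proof.
move=> G4 /Z1_emb[f f_inj f_mono].
by apply: iso_of_emb f_inj f_mono _; rewrite card_ord G4.
Qed.

(** * The pair forced when [R] lies in K_{4,5} *)

Section Forced.
Variables R S : sgraph.
Hypotheses (R_conn : sg_connected R) (S_conn : sg_connected S).
Hypotheses (R4 : 4 <= #|R|) (S4 : 4 <= #|S|).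
Hypothesis forced : forall g, counterexample g -> lies_in R g \/ lies_in S g.
Hypothesis R_K45 : lies_in R K45.

Lemma claw_or_C4_in_R : contains R star_adj 4 \/ contains R bip_adj 4.
Proof.
have [s /K45_claw_or_C4 s_in s_R] := lies_in_grow_seq R_K45 R_conn R4.
by case/orP: s_in => /s_R; [left | right].
Qed.

Lemma S_LPetersen : lies_in S LPetersen.
Proof.
case: (forced LPetersen_counterexample) => // RL; case: claw_or_C4_in_R.
  by case/(lies_in_avoids RL); vm_compute.
by case/(lies_in_avoids RL); vm_compute.
Qed.

(** If [S] had such a pattern it would lie in neither graph, so [R] would lie in both; but one has
    no claw and the other no induced C_4. *)
Lemma S_avoids r k :
    occs (table_adj twoCliques) r k (vertices twoCliques) = false ->
    occs (table_adj K4coK5) r k (vertices K4coK5) = false ->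
  ~ contains S r k.
Proof.
move=> r1 r2 Sr.
case: (forced twoCliques_counterexample) => [R1 | /lies_in_avoids/(_ r k r1)]; last by [].
case: (forced K4coK5_counterexample) => [R2 | /lies_in_avoids/(_ r k r2)]; last by [].
case: claw_or_C4_in_R.
  by case/(lies_in_avoids R1); vm_compute.
by case/(lies_in_avoids R2); vm_compute.
Qed.

Lemma S_no_P4 : ~ contains S path_adj 4.
Proof. by apply: S_avoids; vm_compute. Qed.

Lemma S_no_bowtie : ~ contains S bowtie_adj 5.
Proof. by apply: S_avoids; vm_compute. Qed.

Lemma S_Z1 : contains S bowtie_adj 4.
Proof.
have [s /LPetersen_P4_or_Z1 s_in s_S] := lies_in_grow_seq S_LPetersen S_conn S4.
by case/orP: s_in => /s_S // /S_no_P4.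
Qed.

Lemma card_S : #|S| = 4.
Proof.
apply/eqP; rewrite eqn_leq S4 andbT leqNgt; apply/negP=> S5.
have [s [x [s_in x_in s_S]]] := lies_in_grow S_LPetersen S_conn S5 S_Z1.
by case/orP: (LPetersen_grow_Z1 s_in x_in) => /s_S; [apply: S_no_P4 | apply: S_no_bowtie].
Qed.

Lemma R_Robertson : lies_in R Robertson.
Proof.
case: (forced Robertson_counterexample) => // SD.
by case: (lies_in_avoids SD _ S_Z1); vm_compute.
Qed.

Lemma R_no_C4 : ~ contains R bip_adj 4.
Proof. by apply: (lies_in_avoids R_Robertson); vm_compute. Qed.

Lemma R_grow_star k :
  K45_star_check k -> k < #|R| -> contains R star_adj k -> contains R star_adj k.+1.
Proof.
move=> check Rk Rstar.
have [s [x [s_in x_in s_R]]] := lies_in_grow R_K45 R_conn Rk Rstar.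
by case/orP: (K45_grow_star check s_in x_in) => /s_R // /R_no_C4.
Qed.

Lemma forced_pair :
  sg_iso S Z1 /\ (sg_iso R (star 3) \/ sg_iso R (star 4)).
Proof.
split; first exact: Z1_iso card_S S_Z1.
have claw : contains R star_adj 4 by case: claw_or_C4_in_R => // /R_no_C4.
have := R4; rewrite leq_eqVlt => /predU1P[/esym R4' | R5]; first by left; apply: star_iso.
have K14 : contains R star_adj 5.
  by apply: R_grow_star R5 claw; vm_compute.
have := R5; rewrite leq_eqVlt => /predU1P[/esym R5' | R6]; first by right; apply: star_iso.
(* Six vertices would make a K_{1,5}, while the Robertson graph is 4-regular. *)
have : contains R star_adj 6.
  by apply: R_grow_star R6 K14; vm_compute.
by case/(lies_in_avoids R_Robertson); vm_compute.
Qed.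

End Forced.

(** A complete [R] on at most three vertices embeds in the triangle spanned by three consecutive
    vertices of the H^2; any other connected one is P_3. *)
Lemma four_vertices (R G : sgraph) :
    sg_connected R -> ~ sg_iso R (path_graph 3) ->
    9 <= #|G| -> has_H2 G -> ~ has_induced R G -> 4 <= #|R|.
Proof.
move=> R_conn R_P3 G9 GH2 RG; rewrite ltnNge; apply/negP => R3.
case: (boolP [forall x : R, forall y : R, (x != y) ==> sedge x y]) => R_compl.
  apply/RG/has_inducedP.
  have [x0 _] : exists x : G, x \in G by apply/card_gt0P; apply: leq_trans G9.
  have [s [s8 bs _]] := H2_window x0 GH2 G9.
  have := buildable_drop 5 bs.
  have : size (drop 5 s) = 3 by rewrite size_drop s8.
  case: (drop 5 s) => [|a [|b [|c [|]]]] //= _.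
  rewrite !inE /window_rule /= !andbT => /and3P[/norP[ab ac] /andP[eab eac] /andP[bc ebc]].
  have tri : {in [:: a; b; c] &, forall x y : G, x != y -> sedge x y}.
    move=> x y; rewrite !inE.
    by do 2![case/or3P=> /eqP->]; rewrite ?eqxx // sedge_sym.
  have tri_uniq : uniq [:: a; b; c] by rewrite /= !inE negb_or ab ac bc.
  pose f (x : R) := nth a [:: a; b; c] (enum_rank x).
  have f_lt (x : R) : enum_rank x < 3 by apply: leq_trans (ltn_ord _) R3.
  have f_in x : f x \in [:: a; b; c] by apply: mem_nth; apply: f_lt.
  have f_inj : injective f.
    by move=> x y /eqP; rewrite /f nth_uniq ?f_lt // => /eqP/val_inj/enum_rank_inj.
  exists f => // x y; have [-> | xy] := eqVneq x y; first by rewrite !sedge_irr.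
  rewrite tri ?f_in ?(inj_eq f_inj) //.
  by move/forallP/(_ x)/forallP/(_ y)/implyP: R_compl => ->.
move: R_compl; rewrite negb_forall => /existsP[x]; rewrite negb_forall => /existsP[y].
rewrite negb_imply => /andP[xy nxy].
have R_gt1 : 1 < #|R|.
  by apply: leq_trans (max_card (mem [:: x; y])); rewrite (card_uniqP _) //= inE xy.
(* A neighbour [z] of [x] and a neighbour [t] of [y] must both be the one remaining vertex. *)
have [z zx] := @connected_grow R [:: x] R_conn R_gt1.
have [t ty] := @connected_grow R [:: y] R_conn R_gt1.
rewrite /grow_rule /= !orbF => ety ezx; rewrite !inE in zx ty.
have zy : z != y by apply: contraNneq nxy => <-; rewrite sedge_sym.
have xyz_uniq : uniq [:: x; y; z] by rewrite /= !inE negb_or xy eq_sym zx eq_sym zy.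
have xyzR : #|[:: x; y; z]| = 3 by rewrite (card_uniqP xyz_uniq).
have tz : t = z.
  have : t \in [:: x; y; z].
    have /subset_leqif_cards : [set u in [:: x; y; z]] \subset [set: R] by apply/subsetP.
    rewrite cardsE cardsT xyzR => -[R3' /esym].
    by rewrite eqn_leq R3' R3 => /eqP/setP/(_ t); rewrite !inE.
  rewrite !inE (negPf ty) => /or3P[/eqP tx | // | /eqP //].
  by rewrite tx (negPf nxy) in ety.
subst t.
have bs : buildable (occ_rule (@sedge R) path_adj) [:: y; z; x].
  rewrite /= !inE negb_or eq_sym zy eq_sym xy zx /occ_rule /rev /= ezx.
  by rewrite sedge_sym (negPf nxy) sedge_sym ety.
have [||i j ij|f f_inj f_mono] := @emb_of_occ R 3 (@path_rel 3) path_adj [:: y; z; x] _ _ _ erefl bs.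
- exact: path_rel_sym.
- exact: path_rel_irr.
- rewrite /path_rel /path_adj orbC eq_sym; case: eqP => //= _.
  by apply/negbTE; rewrite neq_ltn orbC ltnS ltnW.
apply/R_P3/(@iso_of_emb (path_graph 3) R f f_inj f_mono).
by rewrite card_ord.
Qed.

(** * Sufficiency *)

Lemma sg_connected_of_k_connected k (G : sgraph) :
  0 < k -> k_connected k G -> sg_connected G.
Proof.
move=> k0 [kG /(_ set0)]; rewrite cards0 => /(_ k0)[_ conn]; split.
  exact: leq_ltn_trans kG.
move=> x y; have inT z : z \in ~: (set0 : {set G}) by rewrite !inE.
pose sub z : induced (~: set0) := exist (fun z : G => z \in ~: set0) z (inT z).
have /connectP[p xp yp] := conn (sub x) (sub y).
apply/connectP; exists (map val p); first by apply: (homo_path (f := val)) xp.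
by rewrite -[x]/(val (sub x)) last_map -yp.
Qed.

(** Deleting a neighbourhood of fewer than [k] vertices would isolate [x] from some other surviving
    vertex. *)
Lemma k_connected_degree k (G : sgraph) (x : G) :
  k_connected k G -> k <= #|[set y | sedge x y]|.
Proof.
case=> kG conn; rewrite leqNgt; apply/negP; set N := [set y | _] => Nk.
have [_ N_conn] := conn N Nk.
have xN : x \in ~: N by rewrite !inE sedge_irr.
have [y yN yx] : exists2 y, y \in ~: N & y != x.
  have: 1 < #|~: N| by have := cardsC N; lia.
  case/card_gt1P=> a [b [aN bN ab]].
  by have [ax|] := eqVneq a x; [exists b; rewrite // -ax eq_sym | exists a].
have /connectP[[|z p]] := N_conn (exist (fun z : G => z \in ~: N) x xN)
                             (exist (fun z : G => z \in ~: N) y yN).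
  by move=> _ /(congr1 val)/= yx'; rewrite yx' eqxx in yx.
by case/andP=> xz _ _; have := valP z; rewrite !inE [sedge _ _]xz.
Qed.

(** * Complete multipartite structure *)

Section Multipartite.
Variable G : sgraph.
Hypothesis G_conn : k_connected 4 G.
Hypothesis G_Z1 : ~ has_induced Z1 G.
Hypothesis G_K14 : ~ has_induced (star 4) G.

Local Notation e := (@sedge G).

Lemma paw_free x y z w : e x y -> e y z -> e x z -> e x w -> w != y -> w != z ->
  e w y || e w z.
Proof.
move=> xy yz xz xw wy wz; apply/negPn/negP; rewrite negb_or => /andP[nwy nwz].
apply/G_Z1/has_inducedP/Z1_emb; exists [:: w; z; y; x] => //.
have neq u v : e u v -> u != v by apply: contraTneq => ->; rewrite sedge_irr.
rewrite /= /occ_rule /rev /= !inE !negb_or wz wy (eq_sym w) (neq _ _ xw).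
rewrite (eq_sym z) (neq _ _ yz) (eq_sym z) (neq _ _ xz) (eq_sym y) (neq _ _ xy).
rewrite !(sedge_sym _ x) xy xz xw (sedge_sym z y) yz (negPf nwy) (negPf nwz).
by [].
Qed.

Lemma no_four_independent_nbrs u s :
  uniq s -> size s = 4 -> all (e u) s -> ~ {in s &, forall x y, ~~ e x y}.
Proof.
move=> s_uniq s4 us s_ind; apply/G_K14/has_inducedP/star_emb.
(* The last entry of the list is vertex 0 of the pattern, the centre of the star. *)
exists (rcons s u); first by rewrite size_rcons s4.
move/allP in us.
case: s s_uniq s4 us s_ind => [|a [|b [|c [|d [|]]]]] //= s_uniq _ us s_ind.
have uE x : x \in [:: a; b; c; d] -> (e x u = true) * (x == u = false).
  move=> xs; have ux : e u x by apply: us.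
  by rewrite sedge_sym ux; split=> //; apply: contraTF ux => /eqP->; rewrite sedge_irr.
have iE x y : x \in [:: a; b; c; d] -> y \in [:: a; b; c; d] -> e x y = false.
  by move=> xs ys; apply/negbTE/s_ind.
by rewrite /occ_rule /rev /= !inE !uE ?iE ?inE ?eqxx ?orbT.
Qed.

Lemma triangle_at x : exists y z, [/\ e x y, e x z & e y z].
Proof.
pose s := take 4 (enum [set y | e x y]).
have s4 : size s = 4.
  by rewrite size_takel // -cardE; apply: k_connected_degree.
have s_uniq : uniq s by rewrite take_uniq // enum_uniq.
have xs y : y \in s -> e x y by move/mem_take; rewrite mem_enum inE.
have [/existsP[y /existsP[z /and3P[ys zs yz]]] | no] :=
    boolP [exists y, exists z, [&& y \in s, z \in s & e y z]].
  by exists y, z; rewrite !xs.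
exfalso; apply: (@no_four_independent_nbrs x s) => //; first by apply/allP.
move=> y z ys zs; apply: contra no => yz.
by apply/existsP; exists y; apply/existsP; exists z; rewrite ys zs.
Qed.

Lemma edge_in_triangle x y : e x y -> exists z, e x z && e y z.
Proof.
move=> xy; have [u [v [xu xv uv]]] := triangle_at x.
have [->|yu] := eqVneq y u; first by exists v; rewrite xv.
have [->|yv] := eqVneq y v; first by exists u; rewrite xu sedge_sym.
by case/orP: (paw_free xu uv xv xy yu yv) => ?; [exists u | exists v]; apply/andP.
Qed.

(** Otherwise connectivity gives an edge from some [v] adjacent to the edge [x y] to some [u] that
    is not, and paw-freeness carries adjacency over to [u]. *)
Lemma edge_dominates x y z : e x y -> z != x -> z != y -> e z x || e z y.
Proof.
move=> xy zx zy; apply/negPn/negP=> nz.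
pose N := [set u | [|| u == x, u == y, e u x | e u y]].
have [_ conn] := sg_connected_of_k_connected (isT : 0 < 4) G_conn.
have /connectP[p xp zp] := conn x z.
have [||u uN /hasP[v]] := leaving_edge (@sedge_sym G) (s := enum N) _ xp.
- by rewrite mem_enum inE eqxx.
- by rewrite -zp mem_enum inE (negPf zx) (negPf zy).
rewrite !mem_enum in uN *; move: uN; rewrite !inE !negb_or => /and4P[ux uy nux nuy].
have no_nbr a b : e a b -> e v a -> e v b -> e u v -> e u a || e u b.
  move=> ab va vb uv; have [->|ua] := eqVneq u a; first by rewrite ab orbT.
  have [->|ub] := eqVneq u b; first by rewrite sedge_sym ab.
  by apply: (@paw_free v) => //; rewrite sedge_sym.
(* If [v] sees [a] but not [b], take a triangle [a b c]: paw-freeness at [a] gives [v] adjacent to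
   [c], then at [v] gives [u] adjacent to [c], then at [c] makes [u] adjacent to [a] or [b]. *)
have key a b : e a b -> u != a -> ~~ e u a -> ~~ e u b -> e v a -> e u v -> False.
  move=> ab ua nua nub va uv.
  have [vb|nvb] := boolP (e v b).
    by have := no_nbr a b ab va vb uv; rewrite (negPf nua) (negPf nub).
  have [c /andP[ac bc]] := edge_in_triangle ab.
  have vb : v != b by apply: contraNneq nub => <-.
  have [vc|vc] := eqVneq v c; first by rewrite vc sedge_sym bc in nvb.
  have := @paw_free a b c v ab bc ac; rewrite sedge_sym va (negPf nvb) => /(_ isT vb vc) /= evc.
  have := no_nbr a c ac va evc uv; rewrite (negPf nua) /= => euc.
  have ub : u != b by apply: contraNneq nua => ->; rewrite sedge_sym.
  have := @paw_free c a b u; rewrite sedge_sym ac ab sedge_sym bc sedge_sym euc.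
  by rewrite (negPf nua) (negPf nub) => /(_ isT isT isT isT ua ub).
case/or4P=> [/eqP-> | /eqP-> | vx | vy] uv.
- by rewrite uv in nux.
- by rewrite uv in nuy.
- exact: key xy ux nux nuy vx uv.
- by apply: key uy nuy nux vy uv; rewrite sedge_sym.
Qed.

Lemma nonadjacency_trans x y z : ~~ e x y -> ~~ e y z -> ~~ e x z.
Proof.
move=> xy yz; apply/negP=> xz.
have [yx|yx] := eqVneq y x; first by rewrite yx xz in yz.
have [yz'|yz'] := eqVneq y z; first by rewrite yz' xz in xy.
by have := edge_dominates xz yx yz'; rewrite sedge_sym (negPf xy) (negPf yz).
Qed.

(** A neighbour of [x] is adjacent to the whole part of [x], so four vertices of that part would
    give an induced K_{1,4}. *)
Lemma part_size x : #|[set y | ~~ e x y]| <= 3.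
Proof.
rewrite leqNgt; apply/negP; set C := [set y | _] => C4.
have [u [_ [xu _ _]]] := triangle_at x.
have sC y : y \in take 4 (enum C) -> ~~ e x y by move/mem_take; rewrite mem_enum inE.
apply: (@no_four_independent_nbrs u (take 4 (enum C))).
- by rewrite take_uniq // enum_uniq.
- by rewrite size_takel // -cardE.
- apply/allP=> y /sC xy; apply: contraLR xu => uy.
  by apply: nonadjacency_trans xy _; rewrite sedge_sym.
- by move=> y z /sC xy /sC; apply: nonadjacency_trans; rewrite sedge_sym.
Qed.

End Multipartite.

(** * Arranging the parts in a list *)

Section Arrangement.
Variables (T : finType) (e : rel T).
Hypotheses (e_sym : symmetric e) (e_irr : irreflexive e).
Hypothesis e_trans : forall x y z, ~~ e x y -> ~~ e y z -> ~~ e x z.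

Let part x := [set y | ~~ e x y].
Hypothesis part_le3 : forall x, #|part x| <= 3.

(* Whenever two entries of s are nonadjacent, their positions are related by d. *)
Definition spread (d : nat -> nat -> bool) (s : seq T) :=
  forall x0 i j, i < j < size s -> ~~ e (nth x0 s i) (nth x0 s j) -> d i j.

(* Parts of size three start at multiples of three. *)
Definition close (i j : nat) := (j <= i.+1) || (j == i.+2) && (3 %| i).
Definition adjacent (i j : nat) := j <= i.+1.

(** Vertices of different parts are adjacent, so a nonadjacent pair lies within the block or within
    [s], where positions are shifted by the block size. *)
Lemma spread_cat (d d1 : nat -> nat -> bool) x (s : seq T) :
    (forall i j, i < j < #|part x| -> d i j) ->
    (forall i j, d1 i j -> d (#|part x| + i) (#|part x| + j)) ->
    (forall y, y \in s -> y \notin part x) ->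
    spread d1 s -> spread d (enum (part x) ++ s).
Proof.
move=> d_part d_s s_part s_d1 x0 i j; rewrite size_cat !nth_cat -!cardE => /andP[ij].
have [jC _ _|Cj js] := ltnP j #|part x|; first by apply: d_part; rewrite ij.
have [iC|Ci] := ltnP i #|part x|; last first.
  have [i' Ei] : exists i', i = #|part x| + i' by exists (i - #|part x|); lia.
  have [j' Ej] : exists j', j = #|part x| + j' by exists (j - #|part x|); lia.
  subst i j; rewrite !addKn => /s_d1; rewrite -(ltn_add2l #|part x|) => H.
  by apply/d_s/H; lia.
have : nth x0 (enum (part x)) i \in part x by rewrite -mem_enum mem_nth // -cardE.
have := s_part (nth x0 s (j - #|part x|)); rewrite mem_nth; last by rewrite ltn_subLR.
rewrite !inE => /(_ isT)/negPn xj xi nij.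
by have := e_trans xi nij; rewrite xj.
Qed.

Lemma enumerate_parts (A : {set T}) :
    (forall x, x \in A -> part x \subset A) ->
  exists s, [/\ uniq s, s =i A, spread close s &
    (forall x, x \in A -> #|part x| != 3) -> spread adjacent s].
Proof.
have [m] := ubnP #|A|; elim: m A => // m IHm A Am A_closed.
(* A part of size three is taken first as long as one exists. *)
have [A0 | [x xA x3]] : A = set0 \/ exists2 x, x \in A &
    #|part x| = 3 \/ (forall y, y \in A -> #|part y| != 3).
  have [-> | [x xA]] := set_0Vmem A; [by left | right].
  have [/existsP[y /andP[yA /eqP y3]] | no] := boolP [exists y, (y \in A) && (#|part y| == 3)].
    by exists y => //; left.
  exists x => //; right=> y yA; apply: contra no => y3.
  by apply/existsP; exists y; rewrite yA.
  by exists [::]; split=> // [z | x0 i j | _ x0 i j]; rewrite ?A0 ?inE // andbC.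
have [||s [s_uniq sA s_close s_adj]] := IHm (A :\: part x).
- have : #|A :\: part x| < #|A|.
    apply: proper_card; apply/properP; split; first exact: subsetDl.
    by exists x => //; rewrite !inE e_irr.
  by lia.
- move=> y; rewrite !inE negbK => /andP[xy yA].
  apply/subsetP=> z yz; rewrite !inE negbK (subsetP (A_closed y yA)) // andbT.
  rewrite inE in yz; apply: contraLR xy => xz; apply: e_trans xz _.
  by rewrite e_sym.
have s_part y : y \in s -> y \notin part x by rewrite sA !inE => /andP[].
exists (enum (part x) ++ s); split.
- rewrite cat_uniq enum_uniq s_uniq andbT; apply/hasPn=> y /s_part.
  by rewrite /= mem_enum.
- move=> y; rewrite mem_cat mem_enum sA in_setD.
  by case: (boolP (y \in part x)) => //= /(subsetP (A_closed x xA)).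
- have C3 := part_le3 x; case: x3 => [x3 | no3].
    apply: spread_cat s_part s_close => i j; rewrite x3 /close; first by lia.
    by move=> H; lia.
  (* A shift by one or two destroys divisibility by three, but only parts of size at most two
     remain, so the stronger [adjacent] holds of [s]. *)
  apply: (spread_cat (d1 := adjacent)) => // [i j|i j|]; rewrite /close /adjacent; try lia.
  by apply: s_adj => y; rewrite inE => /andP[_ /no3].
- move=> no3; have C3 := part_le3 x; have := no3 x xA => xn3.
  apply: (spread_cat (d1 := adjacent)) => // [i j|i j|]; rewrite /adjacent; try lia.
  by apply: s_adj => y; rewrite inE => /andP[_ /no3].
Qed.

End Arrangement.

(* For n = 9 this is 0 3 6 1 4 7 2 5 8. *)
Definition stride3 (n i : nat) : nat :=
  let a := (n + 2) %/ 3 in let b := (n + 1) %/ 3 in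
  if i < a then 3 * i else if i < a + b then 3 * (i - a) + 1 else 3 * (i - a - b) + 2.

Lemma stride3_lt n i : i < n -> stride3 n i < n.
Proof. by rewrite /stride3 /=; case: ifP => ?; [|case: ifP => ?]; lia. Qed.

Lemma stride3_inj n i j : i < n -> j < n -> stride3 n i = stride3 n j -> i = j.
Proof.
by rewrite /stride3 /=; do 2![case: ifP => ?; [|case: ifP => ?]]; lia.
Qed.

(** Each residue class has at least three positions, and steps within a class are at least three. A
    step into another class can have length two, as from 3 to 1 when [n = 9], but then the smaller
    position is not a multiple of three. *)
Lemma stride3_spread n i k : 9 <= n -> i < n -> 0 < k <= 2 ->
  let p := stride3 n i in let q := stride3 n ((i + k) %% n) in
  (p < q /\ ~~ close p q) \/ (q < p /\ ~~ close q p).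
Proof.
move=> n9 i_n k2 p q; rewrite {}/p {}/q /close.
have [ik|ik] := ltnP (i + k) n.
  rewrite modn_small // /stride3 /=.
  by do 2![case: ifP => ?; [|case: ifP => ?]]; lia.
have -> : (i + k) %% n = i + k - n by rewrite -[in LHS](subnK ik) modnDr modn_small //; lia.
rewrite /stride3 /=.
by do 2![case: ifP => ?; [|case: ifP => ?]]; lia.
Qed.

(** * From a cyclic list to an H^2 *)

Lemma next_nth_mod (T : eqType) (x0 : T) c i : uniq c -> i < size c ->
  next c (nth x0 c i) = nth x0 c ((i + 1) %% size c).
Proof.
case: c => [|y c] // c_uniq ic; rewrite next_nth mem_nth // index_uniq //.
rewrite addn1; move: ic; rewrite /= ltnS leq_eqVlt => /predU1P[-> | ic].
  (* At the last index [next_nth] reads past the tail, and its default is the head of the list. *)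
  by rewrite nth_default // modnn.
by rewrite modn_small //; apply: set_nth_default.
Qed.

Lemma H2_of_next (G : sgraph) (c : seq G) :
    2 < size c -> uniq c -> (forall x, x \in c) ->
    (forall x, sedge x (next c x) /\ sedge x (next c (next c x))) -> has_H2 G.
Proof.
move=> c2 c_uniq c_all c_next; have e1 x := (c_next x).1; have e2 x := (c_next x).2.
have next_inj : injective (next c) by apply: can_inj (prev_next c_uniq).
exists c; first by split=> //; apply: cycle_from_next => // x _.
have cyc x y : cycle_rel c x y -> y = next c x \/ x = next c y.
  by case/andP=> _ /orP[/eqP<- | /eqP<-]; [left | right].
move=> x y; rewrite /= /square_rel /= => /orP[/cyc[-> | ->] | /andP[xy /existsP[z]]] //.
  by rewrite sedge_sym.
(* Two cycle edges in the same direction give a double successor; in opposite directions they force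
   [x = y]. *)
case/andP=> /cyc[xz | xz] /cyc[zy | zy].
- by rewrite zy xz.
- by move: xy; rewrite (next_inj x y) ?eqxx // -xz.
- by move: xy; rewrite zy -xz eqxx.
- by rewrite xz zy sedge_sym.
Qed.

Lemma sufficiency (G : sgraph) : k_connected 4 G -> ~ has_induced Z1 G ->
  ~ has_induced (star 4) G -> 9 <= #|G| -> has_H2 G.
Proof.
move=> G4 GZ GK G9.
have e_trans := nonadjacency_trans G4 GZ GK.
have part3 := part_size G4 GZ GK.
have [|s [s_uniq sT s_close _]] :=
  enumerate_parts (@sedge_sym G) (@sedge_irr G) e_trans part3 (A := setT).
  by move=> x _; apply: subsetT.
have [x0 _] : exists x : G, x \in G by apply/card_gt0P; apply: leq_trans G9.
have sn : size s = #|G| by rewrite -(card_uniqP s_uniq) -cardsT; apply: eq_card.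
set n := #|G| in G9 sn.
pose c := mkseq (fun i => nth x0 s (stride3 n i)) n.
have cn : size c = n by rewrite size_mkseq.
have c_uniq : uniq c.
  apply/mkseq_uniqP=> i j i_n j_n /eqP.
  by rewrite nth_uniq ?sn ?stride3_lt // => /eqP/stride3_inj; apply.
have c_all x : x \in c.
  have [||_ ->] := uniq_min_size c_uniq (s2 := s); last by rewrite sT inE.
    by move=> y _; rewrite sT inE.
  by rewrite cn sn.
apply: (@H2_of_next G c) => //; first by rewrite cn; lia.
move=> x; have := c_all x; case/(nthP x0) => i; rewrite cn => i_n <-.
have n0 : 0 < n by lia.
have far k : 0 < k <= 2 -> sedge (nth x0 c i) (nth x0 c ((i + k) %% n)).
  move=> k2; rewrite !nth_mkseq ?ltn_pmod //.
  have [[pq npq]|[qp nqp]] := stride3_spread G9 i_n k2.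
    by apply: contraR npq => ne; apply: s_close ne; rewrite pq sn stride3_lt ?ltn_pmod.
  apply: contraR nqp => ne; rewrite sedge_sym in ne; apply: s_close ne.
  by rewrite qp sn stride3_lt.
by rewrite !next_nth_mod ?cn ?ltn_pmod // modnDml -addnA; split; apply: far.
Qed.

(** * Transfer of induced subgraphs and the equivalence *)

Lemma has_induced_of_emb (K H G : sgraph) (f : K -> H) :
  injective f -> {mono f : x y / sedge x y} -> has_induced H G -> has_induced K G.
Proof.
move=> f_inj f_mono /has_inducedP[h h_inj h_mono]; apply/has_inducedP.
by exists (h \o f) => [|x y]; [apply: inj_comp | rewrite /= h_mono f_mono].
Qed.

Lemma has_induced_iso (K H G : sgraph) : sg_iso K H -> has_induced H G -> has_induced K G.
Proof.
case=> f [f' fK f'K] f_mono; apply: (has_induced_of_emb (f := f)) => //.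
exact: can_inj fK.
Qed.

Lemma has_induced_star (G : sgraph) r : has_induced (star r.+1) G -> has_induced (star r) G.
Proof.
apply: (@has_induced_of_emb (star r) (star r.+1) _ (widen_ord (leqnSn _))) => // i j.
by move/(congr1 val) => /= /val_inj.
Qed.

Theorem theorem2 (R S : sgraph)
    (R_connected : sg_connected R) (S_connected : sg_connected S)
    (R_neq_P3 : ~ sg_iso R (path_graph 3))
    (S_neq_P3 : ~ sg_iso S (path_graph 3))
    (non_vacuous : exists G : sgraph,
       [/\ k_connected 4 G, pair_free R S G & 9 <= #|G|]) :
  (forall G : sgraph,
     k_connected 4 G -> pair_free R S G -> 9 <= #|G| -> has_H2 G)
  <-> (same_pair R S (star 3) Z1 \/ same_pair R S (star 4) Z1).
Proof.
split; last first.
  move=> RS G G4 [RG SG] G9; apply: sufficiency => // [Z|K].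
    by case: RS => -[] [iR iS]; [apply: SG | apply: RG | apply: SG | apply: RG];
      apply: (has_induced_iso _ Z).
  (* An induced K_{1,4} contains a claw, so the pair with K_{1,3} is covered too. *)
  have K3 := has_induced_star K.
  by case: RS => -[] [iR iS]; [apply: RG | apply: SG | apply: RG | apply: SG];
    first [exact: (has_induced_iso _ K) | exact: (has_induced_iso _ K3)].
move=> H; have [G [G4 RSG G9]] := non_vacuous.
have GH2 := H G G4 RSG G9; case: RSG => RG SG.
have R4 := four_vertices R_connected R_neq_P3 G9 GH2 RG.
have S4 := four_vertices S_connected S_neq_P3 G9 GH2 SG.
have forced g : counterexample g -> lies_in R g \/ lies_in S g.
  case=> g4 g9 gH2; apply: NNPP => nRS; apply/gH2/H => //; last by rewrite card_ord.
  by split=> /lies_in_of_induced ?; apply: nRS; [left | right].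
have forced' g : counterexample g -> lies_in S g \/ lies_in R g.
  by move/forced=> [] ?; [right | left].
(* Whichever of the two graphs lies in K_{4,5} becomes the star, the other Z_1. *)
case: (forced K45 K45_counterexample) => [RK | SK].
  have [SZ [R3|R4']] := forced_pair R_connected S_connected R4 S4 forced RK.
    by left; left.
  by right; left.
have [RZ [S3|S4']] := forced_pair S_connected R_connected S4 R4 forced' SK.
  by left; right.
by right; right.
Qed.
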